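(* There is an absolute constant $c>0$ such that the following holds. Let $p$ be a prime and let $f_1, f_2:\mathbb F_p \to\mathbb C$. Define $F:\mathbb F_p\to\mathbb C$ by $$F(x) =\frac 1p \sum_{y\in \mathbb F_p^*} f_1 (x+y)\, f_2\Big(x+\frac 1y\Big),$$ where $\frac1y$ denotes the multiplicative inverse of $y$ in $\mathbb F_p$. Then $$\big\Vert F- \mathbb E [f_1]\cdot \mathbb E[f_2]\big\Vert_2 \leq c\,p^{-\frac 1{10}} \Vert f_1\Vert_2\cdot \Vert f_2\Vert_2.$$
   Context: For $f:\mathbb F_p\to\mathbb C$, $\mathbb E[f]=\frac1p\sum_{x\in\mathbb F_p} f(x)$ and $\Vert f\Vert_2=\big(\frac1p\sum_{x\in\mathbb F_p}|f(x)|^2\big)^{1/2}$ (normalized counting measure). $\mathbb F_p^*=\mathbb F_p\setminus\{0\}$. In $F-\mathbb E[f_1]\cdot\mathbb E[f_2]$, the product denotes the constant function. *)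

(* Defs.v *)
From HB Require Import structures.
From mathcomp Require Import all_boot all_order all_algebra.
From mathcomp Require Import complex.
From mathcomp Require Import all_classical all_reals all_analysis.
From mathcomp Require Import Rstruct.
Set Implicit Arguments. Unset Strict Implicit. Unset Printing Implicit Defensive.
Import Order.TTheory GRing.Theory Num.Theory.
Local Open Scope ring_scope.

Notation RR := Rdefinitions.R.
Notation CC := (complex RR).

Definition expec (p : nat) (f : 'F_p -> CC) : CC :=
  (p%:R)^-1 * \sum_(x : 'F_p) f x.

Definition norm2 (p : nat) (f : 'F_p -> CC) : RR :=
  Num.sqrt ((p%:R)^-1 * \sum_(x : 'F_p) (Normc.normc (f x)) ^+ 2).

Definition Fconv (p : nat) (f1 f2 : 'F_p -> CC) (x : 'F_p) : CC :=
  (p%:R)^-1 * \sum_(y : 'F_p | y != 0) f1 (x + y) * f2 (x + y^-1).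

(* Main.v *)
Require Import Defs.
From HB Require Import structures.
From mathcomp Require Import all_boot all_order all_algebra.
From mathcomp Require Import complex.
From mathcomp Require Import all_classical all_reals all_analysis.
From mathcomp Require Import Rstruct.
From mathcomp Require Import ring lra.
Set Implicit Arguments. Unset Strict Implicit. Unset Printing Implicit Defensive.
Import Order.TTheory GRing.Theory Num.Theory.
Local Open Scope ring_scope.

(** Put [u = x + y] and [v = x + 1/y]: then [(u - x) (v - x) = 1], that is
[v = M_x u] for the involutive Moebius map [M_x] of matrix
[[x, 1 - x^2], [1, -x]].  Subtracting its mean from [f2], and extending it by
[0] at infinity, it suffices to bound the operator
[A = \sum_x g(x) pi(M_x)] on mean-zero functions on the projective line,
where [g] is given by duality.  As [A] is symmetric, [|A phi|^4] is at most
[|phi|^2 <phi, A^4 phi>], and [A^4] is a weighted sum over the words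
[M_a M_b M_c M_d].  The identity is hit by such words only when they cancel
trivially, and any other matrix is hit [O(p)] times; so Cauchy-Schwarz over
the matrices [m] of determinant 1 and the Schur-type estimate
[\sum_m <phi, pi(m) phi>^2 <= 4 p^2 |phi|^4] yield [|A| = O(p^(3/8)) |g|],
that is, a saving of [p^(-1/8)].

The projective line is replaced by degree-0 homogeneous functions on the
plane, which multiplies every inner product by [p - 1]. *)

(** * Cauchy-Schwarz inequalities and roots of quadratics *)

Lemma cauchy_schwarz_sum (R : realFieldType) (I : finType) (P : pred I)
    (a b : I -> R) :
  (\sum_(i | P i) a i * b i) ^+ 2
    <= (\sum_(i | P i) a i ^+ 2) * (\sum_(i | P i) b i ^+ 2).
Proof.
(* Lagrange's identity: this double sum is twice the gap between the two sides. *)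
have : 0 <= \sum_(i | P i) \sum_(j | P j) (a i * b j - a j * b i) ^+ 2.
  by apply: sumr_ge0 => i _; apply: sumr_ge0 => j _; apply: sqr_ge0.
have -> : \sum_(i | P i) \sum_(j | P j) (a i * b j - a j * b i) ^+ 2
  = \sum_(i | P i) \sum_(j | P j) a i ^+ 2 * b j ^+ 2
    + \sum_(i | P i) \sum_(j | P j) b i ^+ 2 * a j ^+ 2
    - \sum_(i | P i) \sum_(j | P j) 2 * ((a i * b i) * (a j * b j)).
  rewrite -big_split -sumrB; apply: eq_bigr => i _ /=.
  by rewrite -big_split -sumrB; apply: eq_bigr => j _ /=; ring.
have -> : \sum_(i | P i) \sum_(j | P j) 2 * ((a i * b i) * (a j * b j))
    = 2 * (\sum_(i | P i) a i * b i) ^+ 2.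
  rewrite expr2 big_distrlr mulr_sumr; apply: eq_bigr => i _.
  by rewrite -mulr_sumr.
by rewrite -!big_distrlr /= => h; lra.
Qed.

Lemma cauchy_schwarz_card (R : realFieldType) (I : finType) (P : pred I)
    (a : I -> R) :
  (\sum_(i | P i) a i) ^+ 2 <= #|P|%:R * \sum_(i | P i) a i ^+ 2.
Proof.
have := cauchy_schwarz_sum P (fun=> 1) a.
under eq_bigr do rewrite mul1r.
by under [X in _ <= X * _ -> _]eq_bigr do rewrite expr1n; rewrite sumr_const.
Qed.

Lemma card_quadratic_roots (F : finFieldType) (a0 a1 a2 : F) :
  [|| a0 != 0, a1 != 0 | a2 != 0] ->
  (#|[pred x | (a0 + a1 * x + a2 * x ^+ 2 == 0)%R]| <= 2)%N.
Proof.
move=> nz; rewrite cardE.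
have nzP : Poly [:: a0; a1; a2] != 0.
  apply: contraTneq nz => P0; rewrite !negb_or !negbK.
  have E i : (Poly [:: a0; a1; a2])`_i = 0 by rewrite P0 coef0.
  have := (E 0%N, E 1%N, E 2%N); rewrite !coef_Poly /= => -[[-> ->] ->].
  by rewrite eqxx.
have := max_poly_roots nzP _ (enum_uniq _).
move=> /(_ [pred x | (a0 + a1 * x + a2 * x ^+ 2 == 0)%R]) h.
suff /h /leq_trans : all (root (Poly [:: a0; a1; a2]))
    (enum [pred x | (a0 + a1 * x + a2 * x ^+ 2 == 0)%R]).
  by move=> /(_ _ (size_Poly _)); rewrite ltnS.
apply/allP => x; rewrite mem_enum inE => /eqP E.
by apply/rootP; rewrite horner_Poly /= -[RHS]E; ring.
Qed.

(** * Two by two matrices, and counting words in four Moebius involutions *)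

Section Mat.
Variable F : finFieldType.
Notation vec := (F * F)%type.
Notation mat := ((F * F) * (F * F))%type.
Local Notation q := #|F|.

Definition mat_act (m : mat) (v : vec) : vec :=
  (m.1.1 * v.1 + m.1.2 * v.2, m.2.1 * v.1 + m.2.2 * v.2).

Definition mat_mul (m n : mat) : mat :=
  ((m.1.1 * n.1.1 + m.1.2 * n.2.1, m.1.1 * n.1.2 + m.1.2 * n.2.2),
   (m.2.1 * n.1.1 + m.2.2 * n.2.1, m.2.1 * n.1.2 + m.2.2 * n.2.2)).

Definition mat_one : mat := ((1, 0), (0, 1)).

Definition mat_det (m : mat) : F := m.1.1 * m.2.2 - m.1.2 * m.2.1.

Definition vec_scale (c : F) (v : vec) : vec := (c * v.1, c * v.2).

Definition mat_scale (c : F) (m : mat) : mat := (vec_scale c m.1, vec_scale c m.2).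

Definition mobius (x : F) : mat := ((x, 1 - x ^+ 2), (1, - x)).

(** Here [X] is not a matrix but a quadruple of points (a, b, c, d), which happens to have the same
    type. *)
Definition word (X : mat) : mat :=
  mat_mul (mobius X.1.1)
    (mat_mul (mobius X.1.2) (mat_mul (mobius X.2.1) (mobius X.2.2))).

Lemma mat_act_mul m n v : mat_act (mat_mul m n) v = mat_act m (mat_act n v).
Proof. by rewrite /mat_act /mat_mul /=; congr pair; ring. Qed.

Lemma mat_act1 v : mat_act mat_one v = v.
Proof. by case: v => s t; rewrite /mat_act /=; congr pair; ring. Qed.

Lemma mat_det_mul m n : mat_det (mat_mul m n) = mat_det m * mat_det n.
Proof. by rewrite /mat_det /=; ring. Qed.

Lemma mat_det_word X : mat_det (word X) = 1.
Proof. by rewrite /word !mat_det_mul /mat_det /=; ring. Qed.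

Lemma mat_act_scale m c v : mat_act m (vec_scale c v) = vec_scale c (mat_act m v).
Proof. by rewrite /mat_act /vec_scale /=; congr pair; ring. Qed.

Lemma mat_scale_act m c v : mat_act (mat_scale c m) v = vec_scale c (mat_act m v).
Proof. by rewrite /mat_act /vec_scale /=; congr pair; ring. Qed.

Lemma mobiusK x : involutive (mat_act (mobius x)).
Proof. by case=> s t; rewrite /mat_act /=; congr pair; ring. Qed.

Lemma mat_mulA : associative mat_mul.
Proof. by move=> m n k; rewrite /mat_mul /=; congr (_, _, (_, _)); ring. Qed.

Lemma mobius_sqr x : mat_mul (mobius x) (mobius x) = mat_one.
Proof. by rewrite /mat_mul /mat_one /=; congr (_, _, (_, _)); ring. Qed.

Lemma mat_mulm1 m : mat_mul m mat_one = m.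
Proof.
by case: m => [[? ?] [? ?]]; rewrite /mat_mul /=; congr (_, _, (_, _)); ring. Qed.

Lemma mat_mul1m m : mat_mul mat_one m = m.
Proof.
by case: m => [[? ?] [? ?]]; rewrite /mat_mul /=; congr (_, _, (_, _)); ring. Qed.

Lemma mul_mobius a b : mat_mul (mobius a) (mobius b) =
  ((1 - a * (a - b), (a - b) * (1 + a * b)), (b - a, 1 + b * (a - b))).
Proof. by rewrite /mat_mul /=; congr (_, _, (_, _)); ring. Qed.

(** Each letter is its own inverse, so the last two move across in reverse order; both sides then
    have the entries of [mul_mobius]. *)
Lemma word_eq a b c d m : word ((a, b), (c, d)) = m ->
  mat_mul (mobius a) (mobius b) = mat_mul m (mat_mul (mobius d) (mobius c)).
Proof.
move=> <-; rewrite /word /= -!mat_mulA (mat_mulA (mobius d)) mobius_sqr mat_mul1m.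
by rewrite mobius_sqr mat_mulm1.
Qed.

(** The lower-left entries give b - a = c - d. If this is 0, the word cancels in adjacent pairs;
    otherwise the upper-left entries can be divided by it, which gives a = d. *)
Lemma word_eq1 a b c d : word ((a, b), (c, d)) = mat_one ->
  (a = b /\ c = d) \/ (a = d /\ b = c).
Proof.
move=> /word_eq; rewrite mat_mul1m !mul_mobius => -[E1 _ E2 _].
have [ab|nab] := eqVneq a b.
  by left; split=> //; apply/eqP; rewrite -subr_eq0 -E2 ab subrr.
right; have nz : b - a != 0 by rewrite subr_eq0 eq_sym.
have ad : a = d.
  apply: (mulfI nz); rewrite {2}E2.
  have -> : (b - a) * a = (1 - a * (a - b)) - 1 by ring.
  by rewrite E1; ring.
by split=> //; move: E2; rewrite ad => /addIr.
Qed.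

(** Coefficients, as polynomials in [d], of
[2 - (a - b)^2 - tr (m M_d M_c)] where [e = d - c]; it vanishes as soon as
[M_a M_b M_c M_d = m], because [M_a M_b = m M_d M_c] expresses [a - b] in
terms of [c] and [d]. *)
Definition trace_coef0 (m : mat) (e : F) : F :=
  2 - (m.2.2 * e - m.2.1) ^+ 2 - m.1.1 + m.1.2 * e - m.2.1 * e - m.2.2
  + m.2.2 * e ^+ 2.

Definition trace_coef1 (m : mat) (e : F) : F :=
  - 2 * m.2.1 * e * (m.2.2 * e - m.2.1) + m.1.1 * e + m.2.1 * e ^+ 2
  - m.2.2 * e.

Definition trace_coef2 (m : mat) (e : F) : F := - m.2.1 ^+ 2 * e ^+ 2 - m.2.1 * e.

Lemma word_trace a b c d m (e := d - c) : word ((a, b), (c, d)) = m ->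
  [/\ a - b = m.2.1 * (d * e - 1) + m.2.2 * e,
      1 - a * (a - b) = m.1.1 * (1 - d * e) - m.1.2 * e &
      trace_coef0 m e + trace_coef1 m e * d + trace_coef2 m e * d ^+ 2 = 0].
Proof.
rewrite /e => /word_eq; rewrite !mul_mobius /mat_mul /= => -[E1 _ E3 E4].
have H1 : a - b = m.2.1 * (d * (d - c) - 1) + m.2.2 * (d - c).
  by rewrite -opprB E3; ring.
split=> //; first by rewrite E1; ring.
have := congr2 +%R E1 E4.
have -> : 1 - a * (a - b) + (1 + b * (a - b)) = 2 - (a - b) ^+ 2 by ring.
rewrite H1 => /eqP; rewrite -subr_eq0 => /eqP <-.
by rewrite /trace_coef0 /trace_coef1 /trace_coef2; ring.
Qed.

(** At these [e] the curve contains every [d]. If the lower-left entry ka is nonzero, [trace_coef2]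
    is a nonzero quadratic in [e]. If ka = 0 and the diagonal entries differ, [trace_coef1] is
    linear; if they agree, their square is 1, and [trace_coef0] is a quadratic that vanishes
    identically only for the identity. *)
Lemma bad_slopes (m : mat) : mat_det m = 1 -> m != mat_one ->
  (#|[pred e | [&& trace_coef0 m e == 0, trace_coef1 m e == 0
                 & trace_coef2 m e == 0]%R]| <= 2)%N.
Proof.
case: m => [[al be] [ka la]].
rewrite /mat_det /trace_coef0 /trace_coef1 /trace_coef2 /= => D N1.
have [ka0|ka0] := eqVneq ka 0.
  subst ka; have [alla|alla] := eqVneq al la.
    subst la; apply: leq_trans (@card_quadratic_roots F (2 - 2 * al) be (al - 1) _).
      apply/subset_leq_card/fintype.subsetP => e; rewrite !inE => /and3P[/eqP E _ _].
      have a2 : al ^+ 2 = 1 by rewrite -D; ring.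
      apply/eqP; rewrite -[RHS]E; ring: a2.
    apply: contraNT N1; rewrite !negb_or !negbK => /and3P[_ /eqP-> ].
    by rewrite subr_eq0 => /eqP ->.
  apply: leq_trans (@card_quadratic_roots F 0 (al - la) 0 _).
    apply/subset_leq_card/fintype.subsetP => e; rewrite !inE => /and3P[_ /eqP E _].
    by apply/eqP; rewrite -[RHS]E; ring.
  by rewrite subr_eq0 alla orbT.
apply: leq_trans (@card_quadratic_roots F 0 (-1) (- ka) _).
  apply/subset_leq_card/fintype.subsetP => e; rewrite !inE => /and3P[_ _ /eqP E].
  by apply/eqP/(mulfI ka0); rewrite mulr0 -[RHS]E; ring.
by rewrite !oppr_eq0 ka0 !orbT.
Qed.

Lemma card_pairs (I J : finType) (Z : pred (I * J)) :
  #|Z| = (\sum_j #|[pred i | Z (i, j)]|)%N.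
Proof.
rewrite -sum1_card big_mkcond /=.
have -> : (\sum_z (if z \in Z then 1 else 0) =
  \sum_i \sum_j (if (i, j) \in Z then 1 else 0))%N.
  by rewrite pair_bigA; apply: eq_bigr => -[].
by rewrite exchange_big; apply: eq_bigr => j _; rewrite -big_mkcond sum1_card.
Qed.

Lemma leq_card_inj (S T : finType) (f : S -> T) (A : pred S) (B : pred T) :
  {in A &, injective f} -> {in A, forall x, B (f x)} -> (#|A| <= #|B|)%N.
Proof.
move=> inj sub; rewrite -(card_in_image inj).
apply/subset_leq_card/fintype.subsetP.
by move=> _ /fintype.imageP[x Ax ->]; exact: sub.
Qed.

(** Each [e] carries at most 2 values of [d], except at most 2 bad [e], which carry up to q: in all
    2q + 2q. *)
Lemma card_trace_curve (m : mat) : mat_det m = 1 -> m != mat_one ->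
  (#|[pred z : F * F |
      (trace_coef0 m z.2 + trace_coef1 m z.2 * z.1
       + trace_coef2 m z.2 * z.1 ^+ 2 == 0)%R]|
    <= 4 * q)%N.
Proof.
move=> D N1; rewrite card_pairs.
pose bad e := [&& trace_coef0 m e == 0, trace_coef1 m e == 0 & trace_coef2 m e == 0].
apply: leq_trans (_ : \sum_(e : F) (2 + if bad e then q else 0) <= _)%N.
  apply: leq_sum => e _; case: ifP => [_|/negbT].
    by apply: leq_trans (max_card _) _; exact: leq_addl.
  by rewrite /bad !negb_and addn0; exact: card_quadratic_roots.
rewrite big_split /= sum_nat_const -big_mkcond sum_nat_const.
have /leq_mul := bad_slopes D N1; move=> /(_ q q (leqnn _)).
rewrite (_ : #|[pred e | bad e]| = #|bad|) // => h.
rewrite (_ : #|xpredT| = q) // (_ : 4 = 2 + 2)%N // mulnDl.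
by rewrite (mulnC q) leq_add2l.
Qed.

(** 5q = q + 4q. If a = b, the word collapses to M_c M_d, which is not the identity and so
    determines c and d, leaving a free. Otherwise (d, d - c) lies on the trace curve and determines
    the word. *)
Lemma card_word (m : mat) : m != mat_one ->
  (#|[pred X | word X == m]| <= 5 * q)%N.
Proof.
move=> N1; have [D|D] := eqVneq (mat_det m) 1; last first.
  rewrite eq_card0 // => X; rewrite !inE.
  by apply: contraNF D => /eqP <-; rewrite mat_det_word.
rewrite -(cardID [pred X | X.1.1 == X.1.2]) mulSn; apply: leq_add.
  apply: (@leq_card_inj _ _ (fun X : mat => X.1.1) _ predT) => //.
  move=> [[a b] [c d]] [[a' b'] [c' d']] /andP[/= /eqP W /eqP ab].
  move=> /andP[/= /eqP W' /eqP a'b'] aa'; rewrite /= in ab a'b' aa'; subst b b' a'.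
  have red x y : word ((a, a), (x, y)) = mat_mul (mobius x) (mobius y).
    by rewrite /word /= mat_mulA mobius_sqr mat_mul1m.
  move: W W'; rewrite !red => W W'; have := W; rewrite -W' !mul_mobius.
  case=> E1 _ E2 _; have nz : c - d != 0.
    apply: contraNneq N1 => /eqP; rewrite subr_eq0 => /eqP cd.
    by rewrite -W cd mobius_sqr.
  have cc' : c = c'.
    apply: (mulIf nz); move: E1 => /addrI/oppr_inj ->.
    by rewrite -(opprB d) E2 opprB.
  by subst c'; move: E2 => /addIr ->.
apply: leq_trans (card_trace_curve D N1).
apply: (@leq_card_inj _ _ (fun X : mat => (X.2.2, X.2.2 - X.2.1))).
  move=> [[a b] [c d]] [[a' b'] [c' d']] /andP[/= nab /eqP W].
  move=> /andP[/= nab' /eqP W'] [/= dd' E]; subst d'.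
  have {E} cc' : c = c' by move: E => /addrI/oppr_inj.
  subst c'; have [A1 A2 _] := word_trace W; have [B1 B2 _] := word_trace W'.
  have E : a - b = a' - b' by rewrite A1 B1.
  have nz : a - b != 0 by rewrite subr_eq0.
  have aa' : a = a'.
    by apply: (mulIf nz); rewrite {2}E; move: A2; rewrite -B2 => /addrI/oppr_inj.
  by subst a'; move: E => /addrI/oppr_inj ->.
move=> [[a b] [c d]] /andP[/= nab /eqP W] /=.
by have [_ _ /eqP] := word_trace W.
Qed.

End Mat.

(** * Second moment of the matrix coefficients *)

Section Op.
Variables (F : finFieldType) (R : realFieldType).
Notation vec := (F * F)%type.
Notation mat := ((F * F) * (F * F))%type.
Local Notation q := #|F|.

Definition homogeneous (phi : vec -> R) :=
  forall c v, c != 0 -> phi (vec_scale c v) = phi v.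

(** Defined for singular [m] as well, so that it can first be summed over all matrices, where images
    of a frame range freely. *)
Definition matcoef (phi : vec -> R) (m : mat) : R :=
  \sum_v phi v * phi (mat_act m v).

(** For a basis (v, w), sending m to (m v, m w) is a bijection onto pairs of vectors; injectivity is
    Cramer's rule applied to each row. *)
Lemma frame_sum (v w : vec) (h : vec * vec -> R) :
  v.1 * w.2 - v.2 * w.1 != 0 ->
  \sum_(m : mat) h (mat_act m v, mat_act m w) = \sum_z h z.
Proof.
move=> D; have row (a b a' b' : F) : a * v.1 + b * v.2 = a' * v.1 + b' * v.2 ->
    a * w.1 + b * w.2 = a' * w.1 + b' * w.2 -> a = a' /\ b = b'.
  move=> E1 E2; split; apply: (mulIf D); apply/eqP; rewrite -subr_eq0.
    have -> : a * (v.1 * w.2 - v.2 * w.1) - a' * (v.1 * w.2 - v.2 * w.1) =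
      w.2 * ((a * v.1 + b * v.2) - (a' * v.1 + b' * v.2))
      - v.2 * ((a * w.1 + b * w.2) - (a' * w.1 + b' * w.2)) by ring.
    by rewrite E1 E2 !subrr !mulr0 subrr.
  have -> : b * (v.1 * w.2 - v.2 * w.1) - b' * (v.1 * w.2 - v.2 * w.1) =
    v.1 * ((a * w.1 + b * w.2) - (a' * w.1 + b' * w.2))
    - w.1 * ((a * v.1 + b * v.2) - (a' * v.1 + b' * v.2)) by ring.
  by rewrite E1 E2 !subrr !mulr0 subrr.
have inj : injective (fun m : mat => (mat_act m v, mat_act m w)).
  move=> [[a b] [c d]] [[a' b'] [c' d']] [/= E1 E2 E3 E4].
  by have [-> ->] := row _ _ _ _ E1 E3; have [-> ->] := row _ _ _ _ E2 E4.
by rewrite [RHS](reindex_inj inj).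
Qed.

Section Schur.
Variable phi : vec -> R.
Hypotheses (phi_hom : homogeneous phi) (phi0 : phi (0, 0) = 0)
  (sum_phi : \sum_v phi v = 0).

Local Notation S := (\sum_v phi v ^+ 2).

Lemma sum_sqr_ge0 : 0 <= S.
Proof. by apply: sumr_ge0 => v _; exact: sqr_ge0. Qed.

(** Completing v to a basis shows that m v takes each value in the plane for exactly q^2
    matrices. *)
Lemma orbit_sum (v : vec) : v != (0, 0) ->
  \sum_(m : mat) phi (mat_act m v) ^+ 2 = q%:R ^+ 2 * S.
Proof.
move=> v0; have [w D] : exists w : vec, v.1 * w.2 - v.2 * w.1 != 0.
  have [v1|v1] := eqVneq v.1 0; last by exists (0, 1); rewrite /= mulr1 mulr0 subr0.
  exists (1, 0); rewrite /= mulr0 mulr1 sub0r oppr_eq0.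
  by apply: contraNneq v0 => v2; case: v v1 v2 => ? ? /= -> ->.
rewrite (frame_sum (fun z => phi z.1 ^+ 2) D) -(pair_bigA _ (fun y _ => phi y ^+ 2)).
under eq_bigr do rewrite sumr_const card_prod -mulr_natl.
by rewrite -mulr_sumr natrM expr2.
Qed.

Lemma card_line (v : vec) : v != (0, 0) ->
  (#|[pred w : vec | (v.1 * w.2 - v.2 * w.1 == 0)%R]| <= q)%N.
Proof.
move=> v0; have [v1|v1] := eqVneq v.1 0.
  have v2 : v.2 != 0.
    by apply: contraNneq v0 => v2; case: v v1 v2 => ? ? /= -> ->.
  apply: (@leq_card_inj _ _ snd _ predT) => // -[a b] [a' b'] /=.
  rewrite !inE /= v1 !mul0r !sub0r !oppr_eq0 !mulf_eq0 (negbTE v2) /=.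
  by move=> /eqP-> /eqP-> ->.
apply: (@leq_card_inj _ _ fst _ predT) => // -[a b] [a' b'] /=.
rewrite !inE /= !subr_eq0 => /eqP E /eqP E' aa'; subst a'.
by congr pair; apply: (mulfI v1); rewrite E E'.
Qed.

(** Pairs [v, w] of independent vectors contribute [(\sum phi)^2 = 0]; the
[O(q)] vectors [w] proportional to [v] are handled by AM-GM. *)
Lemma schur_bound : \sum_(m : mat) matcoef phi m ^+ 2 <= q%:R ^+ 3 * S ^+ 2.
Proof.
pose K v w := \sum_(m : mat) phi (mat_act m v) * phi (mat_act m w).
(* Indicator of dependent pairs. Requiring v to be nonzero keeps the number of partners w at most
   q. *)
pose L (v w : vec) : R :=
  if (v != (0, 0)) && (v.1 * w.2 - v.2 * w.1 == 0) then 1 else 0.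
have -> : \sum_(m : mat) matcoef phi m ^+ 2 =
    \sum_v \sum_w phi v * phi w * K v w.
  transitivity (\sum_(m : mat) \sum_v \sum_w
      phi v * phi w * (phi (mat_act m v) * phi (mat_act m w))).
    apply: eq_bigr => m _; rewrite expr2 big_distrlr.
    by apply: eq_bigr => v _; apply: eq_bigr => w _; rewrite /=; ring.
  rewrite exchange_big; apply: eq_bigr => v _.
  by rewrite exchange_big; apply: eq_bigr => w _; rewrite mulr_sumr.
have sumL v : \sum_w L v w * phi v ^+ 2 <= q%:R * phi v ^+ 2.
  have [->|v0] := eqVneq v (0, 0).
    by rewrite phi0 !expr0n /= mulr0 big1 // => w _; rewrite mulr0.
  rewrite -mulr_suml ler_wpM2r ?sqr_ge0 //.
  rewrite /L v0 -big_mkcond sumr_const ler_nat.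
  exact: card_line v0.
have bnd v w : phi v * phi w * K v w <=
    q%:R ^+ 2 * S * (L v w * phi v ^+ 2 + L w v * phi w ^+ 2) / 2.
  have S0 := sum_sqr_ge0; have q0 : 0 <= q%:R :> R := ler0n _ _.
  have L0 a b : 0 <= L a b by rewrite /L; case: ifP.
  have rhs0 : 0 <= q%:R ^+ 2 * S * (L v w * phi v ^+ 2 + L w v * phi w ^+ 2) / 2.
    by rewrite divr_ge0 // mulr_ge0 ?addr_ge0 // mulr_ge0 ?sqr_ge0.
  have [v0|v0] := eqVneq v (0, 0); first by rewrite {1}v0 phi0 !mul0r.
  have [w0|w0] := eqVneq w (0, 0); first by rewrite {1}w0 phi0 mulr0 mul0r.
  have [D|D] := eqVneq (v.1 * w.2 - v.2 * w.1) 0; last first.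
    rewrite {1}/K (frame_sum (fun z => phi z.1 * phi z.2) D).
    rewrite -(pair_bigA _ (fun y z => phi y * phi z)) -big_distrlr /=.
    by rewrite sum_phi mulr0 mulr0.
  rewrite /L v0 w0 D eqxx /=.
  have -> : w.1 * v.2 - w.2 * v.1 == 0.
    by apply/eqP; rewrite -[RHS]oppr0 -[in RHS]D; ring.
  (* AM-GM with the factors crossed, phi(v) phi(m w) against phi(w) phi(m v), so that both squares
     sum over m by [orbit_sum]. *)
  rewrite !mul1r ler_pdivlMr // /K mulr_sumr mulr_suml.
  have -> : q%:R ^+ 2 * S * (phi v ^+ 2 + phi w ^+ 2) =
     \sum_(m : mat) (phi v ^+ 2 * phi (mat_act m w) ^+ 2
       + phi w ^+ 2 * phi (mat_act m v) ^+ 2).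
    by rewrite big_split /= -!mulr_sumr !orbit_sum //; ring.
  apply: ler_sum => m _; rewrite -subr_ge0.
  rewrite (_ : _ - _ = (phi v * phi (mat_act m w) - phi w * phi (mat_act m v)) ^+ 2).
    exact: sqr_ge0.
  by ring.
apply: le_trans (_ : \sum_v \sum_w
    q%:R ^+ 2 * S * (L v w * phi v ^+ 2 + L w v * phi w ^+ 2) / 2 <= _).
  by apply: ler_sum => v _; apply: ler_sum => w _; exact: bnd.
have sumS : \sum_v \sum_w L v w * phi v ^+ 2 <= q%:R * S.
  by rewrite mulr_sumr; apply: ler_sum => v _; exact: sumL.
have -> : \sum_v \sum_w
    q%:R ^+ 2 * S * (L v w * phi v ^+ 2 + L w v * phi w ^+ 2) / 2 =
    q%:R ^+ 2 * S * \sum_v \sum_w L v w * phi v ^+ 2.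
  under eq_bigr do rewrite -mulr_suml -mulr_sumr big_split /=.
  rewrite -mulr_suml -mulr_sumr big_split /= [X in _ + X]exchange_big /=.
  by field.
have -> : q%:R ^+ 3 * S ^+ 2 = q%:R ^+ 2 * S * (q%:R * S) :> R by ring.
by rewrite ler_wpM2l // mulr_ge0 ?sqr_ge0 ?sum_sqr_ge0.
Qed.

Lemma matcoef_scale c m : c != 0 -> matcoef phi (mat_scale c m) = matcoef phi m.
Proof.
by move=> c0; apply: eq_bigr => v _; rewrite mat_scale_act phi_hom.
Qed.

Lemma mat_scale_inj (c : F) : c != 0 -> injective (@mat_scale F c).
Proof.
move=> c0 [[a b] [e d]] [[a' b'] [e' d']] [] /=.
by move=> /(mulfI c0)-> /(mulfI c0)-> /(mulfI c0)-> /(mulfI c0)->.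
Qed.

Lemma card_nonzero : #|[pred c : F | c != 0]| = q.-1.
Proof. by rewrite -(cardC1 (0 : F)); apply: eq_card => c; rewrite !inE. Qed.

Lemma card_field_gt1 : (1 < q)%N.
Proof. exact: card_finNzRing_gt1. Qed.

Lemma natr_card_pred : q.-1%:R = q%:R - 1 :> R.
Proof. by rewrite -subn1 natrB // ltnW ?card_field_gt1. Qed.

(** A matrix can be written [c m'] with [det m' = 1] for at most two scalars
[c], and [matcoef phi] takes the same value at [m'] and at [c m']. *)
Lemma schur_bound_det1 :
  \sum_(m : mat | mat_det m == 1) matcoef phi m ^+ 2 <= 4 * q%:R ^+ 2 * S ^+ 2.
Proof.
set T := \sum_(m | _) _.
have dtc (c : F) m : mat_det (mat_scale c m) = c ^+ 2 * mat_det m.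
  by rewrite /mat_det /=; ring.
(* Double count of pairs (m, c) with det m = c^2 and c nonzero: scaling by c shows that each c
   contributes one copy of T. *)
have E : (q%:R - 1) * T = \sum_(m : mat)
    \sum_(c : F | (c != 0) && (mat_det m == c ^+ 2)) matcoef phi m ^+ 2.
  rewrite (exchange_big_dep (fun c => c != 0)) /=; last by move=> m c _ /andP[].
  rewrite -natr_card_pred -card_nonzero mulr_natl -sumr_const.
  apply: eq_bigr => c c0.
  rewrite [RHS](reindex_inj (mat_scale_inj c0)) /=; apply: eq_big => [m|m _].
    rewrite [c != 0]c0 dtc -{2}[c ^+ 2]mulr1 (inj_eq (mulfI _)) //.
    by rewrite expf_neq0.
  by rewrite matcoef_scale.
have : (q%:R - 1) * T <= 2 * (q%:R ^+ 3 * S ^+ 2).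
  apply: le_trans (_ : 2 * \sum_(m : mat) matcoef phi m ^+ 2 <= _); last first.
    by rewrite ler_wpM2l // schur_bound.
  rewrite E mulr_sumr; apply: ler_sum => m _.
  rewrite sumr_const -[leLHS]mulr_natl ler_wpM2r ?sqr_ge0 // ler_nat.
  apply: leq_trans (@card_quadratic_roots F (- mat_det m) 0 1 _); last first.
    by rewrite oner_neq0 !orbT.
  apply/subset_leq_card/fintype.subsetP => c; rewrite !inE => /andP[_ /eqP ->].
  by apply/eqP; ring.
have q2 : 2 <= q%:R :> R by rewrite ler_nat card_field_gt1.
have T0 : 0 <= T by apply: sumr_ge0 => m _; exact: sqr_ge0.
have q_gt0 : 0 < q%:R :> R by lra.
(* As q >= 2, q <= 2 (q - 1); with the two square roots c this makes the constant 4. *)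
move=> h; rewrite -(ler_pM2l q_gt0).
apply: le_trans (_ : 2 * ((q%:R - 1) * T) <= _).
  by rewrite mulrA ler_wpM2r //; lra.
rewrite (_ : q%:R * _ = 2 * (2 * (q%:R ^+ 3 * S ^+ 2))); last by ring.
by rewrite ler_wpM2l.
Qed.

End Schur.
End Op.

(** * The weighted operator and its fourth power *)

Section Op2.
Variables (F : finFieldType) (R : realFieldType).
Notation vec := (F * F)%type.
Notation mat := ((F * F) * (F * F))%type.
Local Notation q := #|F|.

Definition mobius_op (g : F -> R) (h : vec -> R) (v : vec) : R :=
  \sum_x g x * h (mat_act (mobius x) v).

Definition weight (g : F -> R) (X : mat) : R :=
  (g X.1.1 * g X.1.2) * (g X.2.1 * g X.2.2).

Lemma sum_quad (h : mat -> R) :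
  \sum_X h X = \sum_a \sum_b \sum_c \sum_d h ((a, b), (c, d)).
Proof.
transitivity (\sum_Y \sum_Z h (Y, Z)).
  by rewrite pair_bigA; apply: eq_bigr => -[].
transitivity (\sum_a \sum_b \sum_Z h ((a, b), Z)).
  by rewrite [RHS]pair_bigA; apply: eq_bigr => -[].
apply: eq_bigr => a _; apply: eq_bigr => b _.
by rewrite pair_bigA; apply: eq_bigr => -[].
Qed.

(** Each M_x is an involution, so the substitution v := M_x v moves it to the other factor. *)
Lemma mobius_op_adj g h k :
  \sum_v mobius_op g h v * k v = \sum_v h v * mobius_op g k v.
Proof.
transitivity (\sum_x \sum_v g x * h (mat_act (mobius x) v) * k v).
  by rewrite exchange_big; apply: eq_bigr => v _; rewrite mulr_suml.
transitivity (\sum_x \sum_v h v * (g x * k (mat_act (mobius x) v))).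
  apply: eq_bigr => x _; rewrite (reindex_inj (inv_inj (mobiusK x))) /=.
  by apply: eq_bigr => v _; rewrite mobiusK; ring.
by rewrite exchange_big; apply: eq_bigr => v _; rewrite mulr_sumr.
Qed.

Lemma mobius_op4 g h :
  \sum_v h v * mobius_op g (mobius_op g (mobius_op g (mobius_op g h))) v
  = \sum_X weight g X * matcoef h (word X).
Proof.
have E v : mobius_op g (mobius_op g (mobius_op g (mobius_op g h))) v =
    \sum_X weight g X * h (mat_act (word X) v).
  rewrite sum_quad /mobius_op.
  (* The outermost operator supplies the letter that acts first, namely d; the exchanges below
     restore the order a, b, c, d. *)
  transitivity (\sum_d \sum_c \sum_b \sum_a
      weight g ((a, b), (c, d)) * h (mat_act (word ((a, b), (c, d))) v)).
    apply: eq_bigr => d _; rewrite mulr_sumr; apply: eq_bigr => c _.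
    rewrite !mulr_sumr; apply: eq_bigr => b _.
    rewrite !mulr_sumr; apply: eq_bigr => a _.
    by rewrite /weight /word /= !mat_act_mul; ring.
  rewrite exchange_big; under eq_bigr do rewrite exchange_big.
  rewrite exchange_big; under eq_bigr do under eq_bigr do rewrite exchange_big.
  under eq_bigr do rewrite exchange_big.
  rewrite exchange_big; apply: eq_bigr => a _; apply: eq_bigr => b _.
  by rewrite exchange_big.
under eq_bigr do rewrite E mulr_sumr.
rewrite exchange_big; apply: eq_bigr => X _.
by rewrite mulr_sumr; apply: eq_bigr => v _; ring.
Qed.

(** By symmetry |A h|^2 = <h, A^2 h> and |A^2 h|^2 = <h, A^4 h>, with Cauchy-Schwarz in between. *)
Lemma mobius_op_sqr g h :
  (\sum_v mobius_op g h v ^+ 2) ^+ 2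
  <= (\sum_v h v ^+ 2) * \sum_X weight g X * matcoef h (word X).
Proof.
rewrite -mobius_op4.
have -> : \sum_v mobius_op g h v ^+ 2 = \sum_v h v * mobius_op g (mobius_op g h) v.
  by rewrite -[RHS]mobius_op_adj; apply: eq_bigr => v _; rewrite expr2.
have -> : \sum_v h v * mobius_op g (mobius_op g (mobius_op g (mobius_op g h))) v
    = \sum_v mobius_op g (mobius_op g h) v ^+ 2.
  by rewrite -[LHS]mobius_op_adj -[LHS]mobius_op_adj; apply: eq_bigr => v _;
    rewrite expr2.
exact: cauchy_schwarz_sum.
Qed.

Variable g : F -> R.
Local Notation N := (\sum_x g x ^+ 2).

Lemma sum_weight_sqr : \sum_X weight g X ^+ 2 = N ^+ 4.
Proof.
rewrite sum_quad.
transitivity (\sum_a \sum_b g a ^+ 2 * g b ^+ 2 * N ^+ 2).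
  apply: eq_bigr => a _; apply: eq_bigr => b _.
  rewrite [N ^+ 2]expr2 big_distrlr mulr_sumr; apply: eq_bigr => c _ /=.
  by rewrite mulr_sumr; apply: eq_bigr => d _; rewrite /weight /=; ring.
under eq_bigr do rewrite -mulr_suml.
by rewrite -mulr_suml -big_distrlr /=; ring.
Qed.

(** The two cancellation patterns [P1] and [P2] each have total weight N^2. On both the weights are
    products of squares, so counting the overlap twice only increases the bound. *)
Lemma sum_weight_one : \sum_(X | word X == mat_one F) weight g X <= 2 * N ^+ 2.
Proof.
pose P1 (X : mat) := (X.1.1 == X.1.2) && (X.2.1 == X.2.2).
pose P2 (X : mat) := (X.1.1 == X.2.2) && (X.1.2 == X.2.1).
have E1 : \sum_X (if P1 X then weight g X else 0) = N ^+ 2.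
  rewrite sum_quad [RHS]expr2 big_distrlr; apply: eq_bigr => a _ /=.
  rewrite (bigD1 a) //= [X in _ + X]big1 ?addr0; last first.
    move=> b nab; rewrite big1 // => c _; rewrite big1 // => d _.
    by rewrite /P1 /= eq_sym (negbTE nab).
  apply: eq_bigr => c _; rewrite (bigD1 c) //= /P1 /= !eqxx /= big1 ?addr0.
    by rewrite /weight /=; ring.
  by move=> d ncd; rewrite eq_sym (negbTE ncd).
have E2 : \sum_X (if P2 X then weight g X else 0) = N ^+ 2.
  rewrite sum_quad [RHS]expr2 big_distrlr; apply: eq_bigr => a _ /=.
  apply: eq_bigr => b _.
  rewrite (bigD1 b) //= [X in _ + X]big1 ?addr0; last first.
    move=> c nbc; rewrite big1 // => d _.
    by rewrite /P2 /= andbC eq_sym (negbTE nbc).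
  rewrite (bigD1 a) //= /P2 /= !eqxx /= big1 ?addr0.
    by rewrite /weight /=; ring.
  by move=> d nad; rewrite eq_sym (negbTE nad).
rewrite mulr_natl mulr2n -{1}E1 -E2 -big_split big_mkcond /=.
apply: ler_sum => -[[a b] [c d]] _.
have W1 : P1 ((a, b), (c, d)) -> 0 <= weight g ((a, b), (c, d)).
  rewrite /P1 /weight /= => /andP[/eqP-> /eqP->].
  by rewrite -!expr2 mulr_ge0 ?sqr_ge0.
have W2 : P2 ((a, b), (c, d)) -> 0 <= weight g ((a, b), (c, d)).
  rewrite /P2 /weight /= => /andP[/eqP-> /eqP->].
  rewrite (_ : _ * _ = (g d * g c) ^+ 2) ?sqr_ge0 //; ring.
case: ifPn => [/eqP/word_eq1 [] [-> ->]|_]; last first.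
  by rewrite addr_ge0 //; case: ifP.
  have -> : P2 (d, c, (c, d)) by rewrite /P2 /= !eqxx.
  rewrite lerDr; case: ifP => //; rewrite /P1 /weight /= => /andP[/eqP-> _].
  by rewrite -!expr2 mulr_ge0 ?sqr_ge0.
have -> : P1 (b, b, (d, d)) by rewrite /P1 /= !eqxx.
rewrite lerDl; case: ifP => // _.
by rewrite /weight /=; rewrite -!expr2 mulr_ge0 ?sqr_ge0.
Qed.

Variable phi : vec -> R.
Hypotheses (phi_hom : homogeneous phi) (phi0 : phi (0, 0) = 0)
  (sum_phi : \sum_v phi v = 0).

Local Notation S := (\sum_v phi v ^+ 2).

(** Words are grouped by their matrix m. Cauchy-Schwarz over m brings in [schur_bound_det1] (factor
    4 q^2), and Cauchy-Schwarz inside each fibre brings in [card_word] (factor 5 q). *)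
Lemma nontrivial_words :
  (\sum_(X | word X != mat_one F) weight g X * matcoef phi (word X)) ^+ 2
  <= 20 * q%:R ^+ 3 * S ^+ 2 * N ^+ 4.
Proof.
pose P (m : mat) := (m != mat_one F) && (mat_det m == 1).
rewrite (partition_big (@word F) P) /=; last first.
  by move=> X nX; rewrite /P nX mat_det_word eqxx.
pose W m := \sum_(X | (word X != mat_one F) && (word X == m)) weight g X.
rewrite (eq_bigr (fun m => matcoef phi m * W m)); last first.
  move=> m _; rewrite mulr_sumr; apply: eq_bigr => X /andP[_ /eqP->].
  by rewrite mulrC.
apply: le_trans (cauchy_schwarz_sum _ _ _) _.
have -> : 20 * q%:R ^+ 3 * S ^+ 2 * N ^+ 4
  = (4 * q%:R ^+ 2 * S ^+ 2) * (5 * q%:R * N ^+ 4) by ring.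
apply: ler_pM; try by apply: sumr_ge0 => m _; exact: sqr_ge0.
  apply: le_trans (schur_bound_det1 phi_hom phi0 sum_phi).
  rewrite [leRHS](bigID (fun m => m != mat_one F)) /= /P.
  rewrite (eq_bigl (fun m => (mat_det m == 1) && (m != mat_one F))).
    by rewrite lerDl; apply: sumr_ge0 => m _; exact: sqr_ge0.
  by move=> m; rewrite andbC.
rewrite -sum_weight_sqr.
apply: le_trans (_ : \sum_(m | P m) 5 * q%:R *
  \sum_(X | (word X != mat_one F) && (word X == m)) weight g X ^+ 2 <= _).
  apply: ler_sum => m /andP[m1 _].
  apply: le_trans (cauchy_schwarz_card _ _) _.
  apply: ler_wpM2r; first by apply: sumr_ge0 => X _; exact: sqr_ge0.
  rewrite -natrM ler_nat; apply: leq_trans (card_word m1).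
  by apply/subset_leq_card/fintype.subsetP => X; rewrite !inE => /andP[].
rewrite -mulr_sumr ler_wpM2l ?mulr_ge0 ?ler0n //.
rewrite -(partition_big (@word F) P) /=; last first.
  by move=> X nX; rewrite /P nX mat_det_word eqxx.
rewrite [leRHS](bigID (fun X => word X != mat_one F)) /= lerDl.
by apply: sumr_ge0 => m _; exact: sqr_ge0.
Qed.

Lemma mobius_op_bound :
  (\sum_v mobius_op g phi v ^+ 2) ^+ 4 <= 48 * q%:R ^+ 3 * S ^+ 4 * N ^+ 4.
Proof.
have := mobius_op_sqr g phi.
rewrite [X in _ <= _ * X -> _](bigID (fun X => word X == mat_one F)) /=.
have -> : \sum_(X | word X == mat_one F) weight g X * matcoef phi (word X)
    = S * \sum_(X | word X == mat_one F) weight g X.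
  rewrite mulr_sumr; apply: eq_bigr => X /eqP->; rewrite mulrC; congr (_ * _).
  by apply: eq_bigr => v _; rewrite mat_act1 expr2.
have := nontrivial_words; have := sum_weight_one; have := sum_sqr_ge0 phi.
have : 0 <= N by apply: sumr_ge0 => x _; exact: sqr_ge0.
have q1 : 1 <= q%:R ^+ 3 :> R by rewrite exprn_ege1 // ler1n ltnW ?card_field_gt1.
move: N S (\sum_(X | word X == mat_one F) weight g X)
  (\sum_(X | word X != mat_one F) weight g X * matcoef phi (word X))
  (\sum_v mobius_op g phi v ^+ 2).
move=> n s w z t n0 s0 wn zb tb.
have tb' : t ^+ 2 <= s * (2 * s * n ^+ 2 + z).
  apply: le_trans tb _; rewrite ler_wpM2l // lerD2r.
  by rewrite (mulrC 2) -mulrA ler_wpM2l.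
have : (t ^+ 2) ^+ 2 <= (s * (2 * s * n ^+ 2 + z)) ^+ 2.
  by rewrite lerXn2r ?nnegrE ?sqr_ge0 // (le_trans (sqr_ge0 t)).
rewrite -exprM => /le_trans; apply.
rewrite exprMn (_ : 48 * _ * _ * _
  = s ^+ 2 * (48 * q%:R ^+ 3 * s ^+ 2 * n ^+ 4)); last by ring.
rewrite ler_wpM2l ?sqr_ge0 //.
(* The constant is 48 = 2 (4 + 20): 4 from the identity words, absorbed using q^3 >= 1, and 20 from
   the others. *)
apply: le_trans (_ : 2 * ((2 * s * n ^+ 2) ^+ 2 + z ^+ 2) <= _).
  rewrite -subr_ge0 (_ : _ - _ = (2 * s * n ^+ 2 - z) ^+ 2) ?sqr_ge0 //; ring.
have s2 : 0 <= s ^+ 2 * n ^+ 4.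
  by rewrite mulr_ge0 ?sqr_ge0 ?exprn_ge0.
have : s ^+ 2 * n ^+ 4 <= q%:R ^+ 3 * (s ^+ 2 * n ^+ 4).
  by rewrite ler_peMl.
rewrite (_ : (2 * s * n ^+ 2) ^+ 2 = 4 * (s ^+ 2 * n ^+ 4)); last by ring.
move=> yb; suff : z ^+ 2 <= 20 * (q%:R ^+ 3 * (s ^+ 2 * n ^+ 4)).
  by move=> zb'; lra.
by apply: le_trans zb _; rewrite le_eqVlt; apply/orP; left; apply/eqP; ring.
Qed.

End Op2.

(** * From the plane back to the field: the real-valued estimate *)

Section Real.
Variables (F : finFieldType) (R : realFieldType).
Notation vec := (F * F)%type.
Local Notation q := #|F|.

(** Extension by [0] at infinity, i.e. on the line [v.2 = 0]. *)
Definition lift_proj (f : F -> R) (v : vec) : R :=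
  if v.2 == 0 then 0 else f (v.1 / v.2).

Lemma lift_proj_hom f : homogeneous (lift_proj f).
Proof.
move=> c [s t] c0; rewrite /lift_proj /= mulf_eq0 (negbTE c0) /=.
by case: ifPn => // t0; rewrite invfM mulrACA divff // mul1r.
Qed.

(** Each of the q - 1 slices at t != 0 is a rescaling of the slice at t = 1. *)
Lemma homogeneous_sum (h : vec -> R) : homogeneous h ->
  \sum_(t | t != 0) \sum_s h (s, t) = (q%:R - 1) * \sum_u h (u, 1).
Proof.
move=> hh; rewrite -natr_card_pred -card_nonzero mulr_natl -sumr_const.
apply: eq_bigr => t t0; rewrite (reindex_inj (mulfI t0)) /=.
by apply: eq_bigr => u _; rewrite -(hh t (u, 1)) // /vec_scale /= mulr1.
Qed.

Lemma homogeneous_sum_vec (h : vec -> R) : homogeneous h ->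
  (forall s, h (s, 0) = 0) ->
  \sum_v h v = (q%:R - 1) * \sum_u h (u, 1).
Proof.
move=> hh h0; rewrite -homogeneous_sum //.
transitivity (\sum_t \sum_s h (s, t)).
  by rewrite exchange_big pair_bigA; apply: eq_bigr => -[].
by rewrite (bigD1 0) //= big1 ?add0r.
Qed.

(** The image under the operator may be nonzero at infinity, where an inequality suffices. *)
Lemma homogeneous_sum_ge (h : vec -> R) : homogeneous h -> (forall v, 0 <= h v) ->
  (q%:R - 1) * \sum_u h (u, 1) <= \sum_v h v.
Proof.
move=> hh h0; rewrite -homogeneous_sum //.
have -> : \sum_v h v = \sum_t \sum_s h (s, t).
  by rewrite exchange_big pair_bigA; apply: eq_bigr => -[].
by rewrite [leRHS](bigD1 0) //= lerDr sumr_ge0.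
Qed.

Lemma lift_proj1 f u : lift_proj f (u, 1) = f u.
Proof. by rewrite /lift_proj /= oner_eq0 divr1. Qed.

(** M_x sends x to infinity, where the lift is 0, so the restriction y != 0 is built in. *)
Lemma lift_mobius f x y : lift_proj f (mat_act (mobius x) (x + y, 1)) =
  if y == 0 then 0 else f (x + y^-1).
Proof.
rewrite /lift_proj /mat_act /=.
rewrite (_ : 1 * (x + y) + - x * 1 = y); last by ring.
by case: ifPn => // y0; congr f; field.
Qed.

(** Duality: the operator is weighted by H itself, so |H|^2 = <f1, K>. Its norm bound has |H| on the
    right, and one power of it cancels. *)
Lemma trilinear_bound (f1 f : F -> R) : \sum_u f u = 0 ->
  (\sum_x (\sum_(y | y != 0) f1 (x + y) * f (x + y^-1)) ^+ 2) ^+ 4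
  <= 48 * q%:R ^+ 3 * (\sum_u f1 u ^+ 2) ^+ 4 * (\sum_u f u ^+ 2) ^+ 4.
Proof.
move=> f0; pose H x := \sum_(y | y != 0) f1 (x + y) * f (x + y^-1).
pose phi := lift_proj f.
have HE x : H x = \sum_u f1 u * phi (mat_act (mobius x) (u, 1)).
  rewrite [RHS](reindex_inj (addrI x)) /H big_mkcond; apply: eq_bigr => y _ /=.
  by rewrite /phi lift_mobius; case: eqP => //=; rewrite mulr0.
pose K u := mobius_op H phi (u, 1).
have q1 : 0 < q%:R - 1 :> R by rewrite subr_gt0 ltr1n card_field_gt1.
have hom2 (h : vec -> R) : homogeneous h -> homogeneous (fun v => h v ^+ 2).
  by move=> hh c v c0 /=; rewrite hh.
have phi_hom : homogeneous phi by exact: lift_proj_hom.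
have phi0 s : phi (s, 0) = 0 by rewrite /phi /lift_proj eqxx.
have opH_hom : homogeneous (mobius_op H phi).
  by move=> c v c0; apply: eq_bigr => x _; rewrite mat_act_scale phi_hom.
have sum_phi : \sum_v phi v = 0.
  rewrite homogeneous_sum_vec //; under eq_bigr do rewrite /phi lift_proj1.
  by rewrite f0 mulr0.
have S_phi : \sum_v phi v ^+ 2 = (q%:R - 1) * \sum_u f u ^+ 2.
  rewrite (homogeneous_sum_vec (hom2 _ phi_hom)); last first.
    by move=> s; rewrite phi0 expr0n.
  by under eq_bigr do rewrite /phi lift_proj1.
have op := mobius_op_bound H phi_hom (phi0 0) sum_phi.
have KT : (q%:R - 1) * \sum_u K u ^+ 2 <= \sum_v mobius_op H phi v ^+ 2.
  by apply: (homogeneous_sum_ge (hom2 _ opH_hom)) => v; exact: sqr_ge0.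
have dual : \sum_x H x ^+ 2 = \sum_u f1 u * K u.
  transitivity (\sum_x \sum_u H x * (f1 u * phi (mat_act (mobius x) (u, 1)))).
    by apply: eq_bigr => x _; rewrite -mulr_sumr -HE expr2.
  rewrite exchange_big; apply: eq_bigr => u _; rewrite mulr_sumr.
  by apply: eq_bigr => x _; ring.
have CS : (\sum_x H x ^+ 2) ^+ 2 <= (\sum_u f1 u ^+ 2) * \sum_u K u ^+ 2.
  by rewrite dual; exact: cauchy_schwarz_sum.
rewrite -[X in X ^+ 4 <= _]/(\sum_x H x ^+ 2).
have sqs (I : finType) (a : I -> R) : 0 <= \sum_i a i ^+ 2.
  by apply: sumr_ge0 => i _; exact: sqr_ge0.
move: op KT CS; rewrite S_phi.
move: (sqs _ H) (sqs _ f1) (sqs _ K) (sqs _ f) (sqs _ (mobius_op H phi)).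
move: (\sum_x H x ^+ 2) (\sum_u f1 u ^+ 2) (\sum_u K u ^+ 2) (\sum_u f u ^+ 2)
  (\sum_v mobius_op H phi v ^+ 2) => h a k s t h0 a0 k0 s0 t0 op KT CS.
have k4 : k ^+ 4 <= 48 * q%:R ^+ 3 * s ^+ 4 * h ^+ 4.
  rewrite -(ler_pM2l (exprn_gt0 4 q1)) -exprMn.
  apply: le_trans (_ : t ^+ 4 <= _).
    by rewrite lerXn2r // nnegrE mulr_ge0 // ltW.
  by apply: le_trans op _; rewrite le_eqVlt; apply/orP; left; apply/eqP; ring.
have h8 : h ^+ 4 * h ^+ 4 <= (48 * q%:R ^+ 3 * a ^+ 4 * s ^+ 4) * h ^+ 4.
  apply: le_trans (_ : a ^+ 4 * k ^+ 4 <= _).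
    by rewrite -exprD -exprMn (exprM h 2 4) lerXn2r ?nnegrE ?sqr_ge0 ?mulr_ge0.
  apply: le_trans (ler_wpM2l (exprn_ge0 4 a0) k4) _.
  by rewrite le_eqVlt; apply/orP; left; apply/eqP; ring.
(* Dividing by h^4 requires h to be nonzero. *)
have [h00|h00] := eqVneq h 0.
  by rewrite h00 expr0n /= !mulr_ge0 ?exprn_ge0 ?ler0n.
by move: h8; rewrite ler_pM2r // exprn_gt0 // lt_def h00.
Qed.

Definition deviation (f1 f2 : F -> R) (x : F) : R :=
  q%:R^-1 * (\sum_(y | y != 0) f1 (x + y) * f2 (x + y^-1))
  - (q%:R^-1 * \sum_u f1 u) * (q%:R^-1 * \sum_u f2 u).

(** Here [t] is q^(3/4), given by its fourth power as [R] is only an ordered field. Removing the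
    mean e of f2 leaves H and, since y = 0 is missing from the sum, the small term e f1(x). *)
Lemma deviation_bound (f1 f2 : F -> R) (t : R) : 0 <= t -> t ^+ 4 = q%:R ^+ 3 ->
  \sum_x deviation f1 f2 x ^+ 2 <=
    8 * t / q%:R ^+ 2 * ((\sum_u f1 u ^+ 2) * \sum_u f2 u ^+ 2).
Proof.
move=> t0 t4.
have q2 : 2 <= q%:R :> R by rewrite ler_nat card_field_gt1.
have q0 : 0 < q%:R :> R by lra.
have qn0 : q%:R != 0 :> R by rewrite gt_eqF.
pose e := q%:R^-1 * \sum_u f2 u; pose f u := f2 u - e.
have sum_e : \sum_u f2 u = q%:R * e by rewrite /e mulrA divff // mul1r.
have sum_f : \sum_u f u = 0.
  by rewrite sumrB sumr_const -[X in _ - X]mulr_natl sum_e subrr.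
pose H x := \sum_(y | y != 0) f1 (x + y) * f (x + y^-1).
have devE x : deviation f1 f2 x = q%:R^-1 * (H x - e * f1 x).
  rewrite /deviation -/e.
  have -> : \sum_(y | y != 0) f1 (x + y) * f2 (x + y^-1)
     = H x + e * \sum_(y | y != 0) f1 (x + y).
    rewrite mulr_sumr -big_split; apply: eq_bigr => y _ /=.
    by rewrite /f; ring.
  have -> : \sum_u f1 u = f1 x + \sum_(y | y != 0) f1 (x + y).
    by rewrite (reindex_inj (addrI x)) (bigD1 0) //= addr0.
  by ring.
have sum_f2 : \sum_u f2 u ^+ 2 = \sum_u f u ^+ 2 + q%:R * e ^+ 2.
  have -> : \sum_u f u ^+ 2 = \sum_u f2 u ^+ 2 - 2 * e * \sum_u f2 u + q%:R * e ^+ 2.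
    rewrite mulr_sumr -sumrB [X in _ = _ + X]mulr_natl -sumr_const -big_split /=.
    by apply: eq_bigr => u _; rewrite /f; ring.
  by rewrite sum_e; ring.
have sqs (I : finType) (a : I -> R) : 0 <= \sum_i a i ^+ 2.
  by apply: sumr_ge0 => i _; exact: sqr_ge0.
(* Lets the term e^2 |f1|^2 be absorbed into the main one. *)
have t1 : 1 <= t.
  rewrite leNgt; apply/negP => tlt.
  have : t ^+ 4 <= 1 by rewrite exprn_ile1 // ltW.
  by rewrite t4; apply/negP; rewrite -ltNge exprn_egt1 // ltr1n card_field_gt1.
have Hb : \sum_x H x ^+ 2 <= 3 * t * ((\sum_u f1 u ^+ 2) * \sum_u f2 u ^+ 2).
  rewrite -(@ler_pXn2r _ 4) ?nnegrE ?sqs //; last by rewrite !mulr_ge0 ?sqs.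
  apply: le_trans (trilinear_bound f1 sum_f) _.
  (* 48 is rounded up to 81 = 3^4 to take fourth roots. *)
  apply: le_trans (_ : 81 * q%:R ^+ 3 * (\sum_u f1 u ^+ 2) ^+ 4 *
    (\sum_u f2 u ^+ 2) ^+ 4 <= _); last first.
    by rewrite -t4 le_eqVlt; apply/orP; left; apply/eqP; ring.
  apply: ler_pM; rewrite ?mulr_ge0 ?exprn_ge0 ?sqs //; last first.
    by rewrite lerXn2r ?nnegrE ?sqs // sum_f2 lerDl mulr_ge0 ?sqr_ge0 // ltW.
  by do 2![apply: ler_wpM2r; first by rewrite exprn_ge0 ?sqs // ltW]; lra.
have eb : e ^+ 2 <= \sum_u f2 u ^+ 2.
  apply: le_trans (_ : q%:R * e ^+ 2 <= _); last by rewrite sum_f2 lerDr sqs.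
  by rewrite ler_peMl ?sqr_ge0 //; lra.
apply: le_trans (_ : 2 / q%:R ^+ 2 *
  (\sum_x H x ^+ 2 + e ^+ 2 * \sum_x f1 x ^+ 2) <= _).
  rewrite mulr_sumr -big_split mulr_sumr /=; apply: ler_sum => x _.
  rewrite devE -subr_ge0.
  rewrite (_ : _ - _ = (q%:R^-1 * (H x + e * f1 x)) ^+ 2) ?sqr_ge0 //.
  by field.
(* 8 t = 2 (3 t + t), with 3 t for H and t for the mean. *)
rewrite (_ : 8 * t / _ * _ = 2 / q%:R ^+ 2 *
   (4 * t * ((\sum_u f1 u ^+ 2) * \sum_u f2 u ^+ 2))); last by field.
rewrite ler_wpM2l ?divr_ge0 ?sqr_ge0 //.
rewrite (_ : 4 * t = 3 * t + t); last by ring.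
rewrite mulrDl lerD // mulrC.
apply: le_trans (ler_wpM2l (sqs _ _) eb) _.
by rewrite ler_peMl // mulr_ge0 ?sqs.
Qed.

End Real.

(** * Complex-valued functions and the final exponent *)

Lemma complex_sum (R : rcfType) (I : finType) (P : pred I) (a b : I -> R) :
  \sum_(i | P i) Complex (a i) (b i)
  = Complex (\sum_(i | P i) a i) (\sum_(i | P i) b i).
Proof. by elim/big_rec3: _ => // i x y z _ ->. Qed.

Lemma normc_sqr (R : rcfType) (z : complex R) :
  Normc.normc z ^+ 2 = complex.Re z ^+ 2 + complex.Im z ^+ 2.
Proof. by case: z => a b; rewrite /= sqr_sqrtr // addr_ge0 ?sqr_ge0. Qed.

(** The deviation is bilinear in (f1, f2), so real and imaginary parts combine as in a product of
    complex numbers. *)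
Lemma Fconv_deviation (p : nat) (f1 f2 : 'F_p -> CC) (x : 'F_p) : prime p ->
  let r1 u := complex.Re (f1 u) in let i1 u := complex.Im (f1 u) in
  let r2 u := complex.Re (f2 u) in let i2 u := complex.Im (f2 u) in
  Fconv f1 f2 x - expec f1 * expec f2
  = Complex (deviation r1 r2 x - deviation i1 i2 x)
            (deviation r1 i2 x + deviation i1 r2 x).
Proof.
move=> pp r1 i1 r2 i2; rewrite /deviation card_Fp //.
have -> : Fconv f1 f2 x = (p%:R)^-1 * Complex
   (\sum_(y | y != 0) (r1 (x + y) * r2 (x + y^-1) - i1 (x + y) * i2 (x + y^-1)))
   (\sum_(y | y != 0) (r1 (x + y) * i2 (x + y^-1) + i1 (x + y) * r2 (x + y^-1))).
  rewrite -complex_sum; congr (_ * _); apply: eq_bigr => y _.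
  by rewrite /r1 /i1 /r2 /i2; case: (f1 _) (f2 _) => [a b] [c d].
have expecE (f : 'F_p -> CC) : expec f =
    (p%:R)^-1 * Complex (\sum_u complex.Re (f u)) (\sum_u complex.Im (f u)).
  by rewrite -complex_sum; congr (_ * _); apply: eq_bigr => y _; case: (f y).
have -> : (p%:R)^-1 = Complex (p%:R^-1 : RR) 0 :> CC.
  by rewrite -[RHS]/(real_complex _ _) fmorphV rmorph_nat.
rewrite !expecE sumrB big_split /=.
have -> : (p%:R)^-1 = Complex (p%:R^-1 : RR) 0 :> CC.
  by rewrite -[RHS]/(real_complex _ _) fmorphV rmorph_nat.
by apply/eqP; rewrite eq_complex /=; apply/andP; split; apply/eqP; ring.
Qed.

Lemma norm2_sqr (p : nat) (f : 'F_p -> CC) :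
  norm2 f ^+ 2 = (p%:R)^-1 *
    (\sum_u complex.Re (f u) ^+ 2 + \sum_u complex.Im (f u) ^+ 2).
Proof.
rewrite /norm2 sqr_sqrtr; last first.
  by rewrite mulr_ge0 ?invr_ge0 // sumr_ge0 // => u _; exact: sqr_ge0.
by rewrite -big_split; congr (_ * _); apply: eq_bigr => u _; rewrite normc_sqr.
Qed.

Theorem theorem3p1 :
  exists c : RR, 0 < c /\
    forall (p : nat) (f1 f2 : 'F_p -> CC), prime p ->
      norm2 (fun x => Fconv f1 f2 x - expec f1 * expec f2)
      <= c * ((p%:R : RR) `^ (- (10%:R)^-1)) * (norm2 f1 * norm2 f2).
Proof.
(* 4^2 = 16 = 2 * 8: 8 from [deviation_bound], 2 from splitting into real and imaginary parts. *)
exists 4; split => // p f1 f2 pp.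
pose t : RR := p%:R `^ (3 / 4).
have p0 : 0 < p%:R :> RR by rewrite ltr0n prime_gt0.
have p1 : 1 <= p%:R :> RR by rewrite ler1n prime_gt0.
have t0 : 0 <= t by exact: powR_ge0.
have t4 : t ^+ 4 = #|'F_p|%:R ^+ 3.
  rewrite card_Fp // -powR_mulrn // -powRrM -(powR_mulrn 3 (ltW p0)).
  by congr (_ `^ _); field.
set s : RR := _ `^ _; have s0 : 0 <= s by exact: powR_ge0.
(* t / p = p^(-1/4), at most p^(-1/5) since p >= 1: the saving p^(-1/8) is weakened to p^(-1/10). *)
have ts : t / p%:R <= s ^+ 2.
  rewrite /t -(powR_inv1 (ltW p0)) -powRD; last by rewrite (gt_eqF p0) implybT.
  rewrite -powR_mulrn // -powRrM ler_powR //; lra.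
have rhs0 : 0 <= 4 * s * (norm2 f1 * norm2 f2).
  by rewrite !mulr_ge0 ?sqrtr_ge0.
rewrite -(@ler_pXn2r _ 2) ?nnegrE ?sqrtr_ge0 //.
rewrite norm2_sqr !exprMn !norm2_sqr.
have dev_le := deviation_bound _ _ t0 t4.
pose r1 u := complex.Re (f1 u); pose i1 u := complex.Im (f1 u).
pose r2 u := complex.Re (f2 u); pose i2 u := complex.Im (f2 u).
(* Reduces to four real deviations, whose bounds add up to the product (R1 + I1) (R2 + I2). *)
have two (a b : 'F_p -> RR) : \sum_x (a x + b x) ^+ 2
    <= 2 * (\sum_x a x ^+ 2 + \sum_x b x ^+ 2).
  rewrite -big_split mulr_sumr; apply: ler_sum => x _ /=.
  by rewrite -subr_ge0 (_ : _ - _ = (a x - b x) ^+ 2) ?sqr_ge0 //; ring.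
have -> : \sum_u complex.Re (Fconv f1 f2 u - expec f1 * expec f2) ^+ 2
    = \sum_x (deviation r1 r2 x + - deviation i1 i2 x) ^+ 2.
  by apply: eq_bigr => x _; rewrite Fconv_deviation.
have -> : \sum_u complex.Im (Fconv f1 f2 u - expec f1 * expec f2) ^+ 2
    = \sum_x (deviation r1 i2 x + deviation i1 r2 x) ^+ 2.
  by apply: eq_bigr => x _; rewrite Fconv_deviation.
have := two (deviation r1 r2) (fun x => - deviation i1 i2 x).
under [X in _ <= 2 * (_ + X) -> _]eq_bigr do rewrite sqrrN.
have := two (deviation r1 i2) (deviation i1 r2).
have := dev_le r1 r2; have := dev_le i1 i2.
have := dev_le r1 i2; have := dev_le i1 r2.
rewrite card_Fp //.
rewrite -[\sum_u complex.Re (f1 u) ^+ 2]/(\sum_u r1 u ^+ 2).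
rewrite -[\sum_u complex.Im (f1 u) ^+ 2]/(\sum_u i1 u ^+ 2).
rewrite -[\sum_u complex.Re (f2 u) ^+ 2]/(\sum_u r2 u ^+ 2).
rewrite -[\sum_u complex.Im (f2 u) ^+ 2]/(\sum_u i2 u ^+ 2).
have sqs (a : 'F_p -> RR) : 0 <= \sum_u a u ^+ 2.
  by apply: sumr_ge0 => u _; exact: sqr_ge0.
have := addr_ge0 (sqs r2) (sqs i2); have := addr_ge0 (sqs r1) (sqs i1).
move: (\sum_u r1 u ^+ 2) (\sum_u i1 u ^+ 2) (\sum_u r2 u ^+ 2) (\sum_u i2 u ^+ 2).
move=> R1 I1 R2 I2 n1_ge0 n2_ge0 le_ir le_ri le_ii le_rr le_im le_re.
apply: le_trans (_ : 16 * (t / p%:R) *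
    ((p%:R)^-1 * (R1 + I1) * ((p%:R)^-1 * (R2 + I2))) <= _).
  rewrite (_ : 16 * _ * _ = p%:R^-1 *
      (2 * (8 * t / p%:R ^+ 2) * ((R1 + I1) * (R2 + I2)))); last first.
    by field; rewrite gt_eqF.
  rewrite ler_wpM2l ?invr_ge0 ?ler0n //.
  move: (8 * t / _) le_ir le_ri le_ii le_rr => k le_ir le_ri le_ii le_rr.
  lra.
rewrite (_ : 4 ^+ 2 = 16); last by ring.
rewrite -2!(mulrA 16) ler_pM2l // ler_wpM2r //.
by rewrite !mulr_ge0 ?invr_ge0 ?ler0n.
Qed.
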